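(* Let $\mathbb{P}$ be a partition of $\Omega$, and let $\mathcal{E}$ be an arbitrary set of conditional events such that $C|D\neq\varnothing|D$ and $C|D\ne D|D$ for every $C|D\in\mathcal{E}$. If $\underline P$ is a W-coherent (alternatively, C-convex) lower probability on $\mathcal{A}_C(\mathbb{P})$, then its lower GN-extension, $\underline P(C|D)=\underline P((C|D)_* )$ for all $C|D\in\mathcal{E}$, is the natural extension (alternatively, the convex natural extension) of $\underline P$ on $\mathcal{A}_C(\mathbb{P})\cup\mathcal{E}$. If $\overline P$ is a W-coherent (alternatively, C-convex) upper probability on $\mathcal{A}_C(\mathbb{P})$, then its upper GN-extension, $\overline P(C|D)=\overline P((C|D)^* )$ for all $C|D\in\mathcal{E}$, is the natural extension (alternatively, the convex natural extension) of $\overline P$ on $\mathcal{A}_C(\mathbb{P})\cup\mathcal{E}$.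
   Context: Events are subsets of a nonempty set $\Omega$ (the sure event); $\wedge,\vee,\neg$ denote intersection, union, complement; $\Rightarrow$ denotes inclusion; an event is identified with its indicator function. A gamble is a bounded function $X:\Omega\to\mathbb{R}$. For an event $B\neq\varnothing$, the conditional gamble $X|B$ is the restriction of $X$ to $B$ (so two conditional gambles with the same $B$ and the same restriction are identified); $\sup(X|B)=\sup_{\omega\in B}X(\omega)$. A conditional event $A|B$ ($B\ne\varnothing$) is the conditional gamble $I_A|B$; in particular $A|B=A\wedge B|B$. Consistency notions, for a set $\mathcal{S}$ of conditional gambles. A map $\underline P:\mathcal{S}\to\mathbb{R}$ (lower prevision) is W-coherent iff for all $n\in\mathbb{N}$, all $X_0|B_0,\dots,X_n|B_n\in\mathcal{S}$ and all real $s_0,\dots,s_n\ge 0$, setting $B=\bigvee_{i=0}^n B_i$ and $\underline G=\sum_{i=1}^n s_iB_i(X_i-\underline P(X_i|B_i))-s_0B_0(X_0-\underline P(X_0|B_0))$, one has $\sup(\underline G|B)\ge 0$. It is convex iff the same condition is required only for stakes with $\sum_{i=1}^n s_i=s_0>0$; it is C-convex (centered convex) iff it is convex and $X|B\in\mathcal{S}$ implies $0|B\in\mathcal{S}$ and $\underline P(0|B)=0$. A map $\overline P:\mathcal{S}\to\mathbb{R}$ (upper prevision) is W-coherent, respectively C-convex, iff the lower prevision $-X|B\mapsto-\overline P(X|B)$ on $\{-X|B: X|B\in\mathcal{S}\}$ is. These are called (lower, upper) probabilities when all elements of $\mathcal{S}$ are conditional events. Convention for C-convexity of extensions: when the assessment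 is extended to events $C|D$, the events $\varnothing|D$ (i.e. $0|D$), if not already present, are understood to be adjoined to the domain with value $0$. For $\mathcal{S}'\supset\mathcal{S}$, the natural extension (respectively convex natural extension) to $\mathcal{S}'$ of a W-coherent (respectively C-convex) $\underline P$ on $\mathcal{S}$ is the least-committal W-coherent (respectively C-convex) extension: it is a W-coherent (respectively C-convex) extension $\underline E$ of $\underline P$ to $\mathcal{S}'$ such that every W-coherent (respectively C-convex) $\underline Q$ on $\mathcal{S}'$ with $\underline Q=\underline P$ on $\mathcal{S}$ satisfies $\underline Q\ge\underline E$. For upper previsions the inequality is reversed (conjugacy): the natural extension is the W-coherent (C-convex) extension $\overline E$ with $\overline Q\le\overline E$ for every W-coherent (C-convex) extension $\overline Q$. A partition $\mathbb{P}$ is a set of pairwise disjoint nonempty events with union $\Omega$; $\mathcal{A}(\mathbb{P})$ is the set of all unions of elements of $\mathbb{P}$; $\mathcal{A}_C(\mathbb{P})=\{A|B: A,B\in\mathcal{A}(\mathbb{P}),\,B\ne\varnothing\}$. For an event $E$: $E_*=\bigvee_{e\in\mathbb{P}:\,e\Rightarrow E}e$ and $E^*=\bigvee_{e\in\mathbb{P}:\,e\wedge E\ne\varnothing}e$. For a conditional event $C|D$ with $C|D\neq\varnothing|D$, $C|D\ne D|D$: $(C|D)_*=(C\wedge D)_*\,|\,[(C\wedge D)_*\vee(\neg C\wedge D)^*]$ and $(C|D)^*=(C\wedge D)^*\,|\,[(C\wedge D)^*\vee(\neg C\wedge D)_*]$; both belong to $\mathcal{A}_C(\mathbb{P})$.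 *)

(* Defs.v *)
From mathcomp Require Import all_boot all_order all_algebra.
From mathcomp Require Import all_classical all_reals all_analysis.

Set Implicit Arguments.
Unset Strict Implicit.
Unset Printing Implicit Defensive.

Import Order.TTheory GRing.Theory Num.Theory.
Import numFieldNormedType.Exports.

Local Open Scope classical_set_scope.
Local Open Scope ring_scope.

(* The conditional gamble X|B, i.e. the restriction to B of a bounded function
   X, is encoded by extending this restriction by 0 outside B: conditional
   gambles with the same B and the same restriction are thus equal
   (cgambleP). *)
Record cgamble (Omega : Type) (R : realType) := CGamble {
  cg_val : Omega -> R ;
  cg_event : set Omega ;
  cg_event_neq0 : cg_event !=set0 ;
  cg_bounded : bounded_fun cg_val ;
  cg_val_out : forall w, ~ cg_event w -> cg_val w = 0 }.

Section ConditionalGambles.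
Context {Omega : Type} {R : realType}.
Implicit Types (g h : cgamble Omega R) (A B : set Omega) (X : Omega -> R).

Lemma cgambleP g h : cg_event g = cg_event h ->
  (forall w, cg_event g w -> cg_val g w = cg_val h w) -> g = h.
Proof.
case: g h => [X B B0 bX X0] [Y C C0 bY Y0] /= BC; subst C => XY.
have ? : X = Y.
  by apply/funext => w; have [/XY//|Bw] := pselect (B w); rewrite X0// Y0.
by subst Y; congr CGamble; exact: Prop_irrelevance.
Qed.

Lemma restrict_bounded X B : bounded_fun X -> bounded_fun (X \_ B).
Proof.
move=> [M [Mr HM]]; exists M; split => // x Mx w _ /=.
rewrite patchE; case: ifP => _; first exact: HM.
have /= := HM x Mx w I; rewrite normr0; exact: le_trans.
Qed.

Lemma restrict_out X B w : ~ B w -> (X \_ B) w = 0.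
Proof. by move=> Bw; rewrite patchE memNset. Qed.

(* X|B *)
Definition cond X (bX : bounded_fun X) B (B0 : B !=set0) : cgamble Omega R :=
  CGamble B0 (restrict_bounded B bX) (@restrict_out X B).

Lemma indic_bounded A : bounded_fun (\1_A : Omega -> R).
Proof.
exists 1; split => // x x1 w _ /=; rewrite indicE.
by case: (w \in A); rewrite ?normr1 ?normr0 ltW // (lt_trans _ x1).
Qed.

(* A|B *)
Definition cevent A B (B0 : B !=set0) : cgamble Omega R :=
  cond (indic_bounded A) B0.

Definition is_cevent g := exists A B (B0 : B !=set0), g = cevent A B0.

Lemma oppg_bounded g : bounded_fun (fun w => - cg_val g w).
Proof.
by have [M [Mr HM]] := cg_bounded g; exists M; split => // x Mx w wT /=;
  rewrite normrN; exact: HM.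
Qed.

Lemma oppg_out g w : ~ cg_event g w -> - cg_val g w = 0.
Proof. by move=> Bw; rewrite (cg_val_out Bw) oppr0. Qed.

(* - X|B *)
Definition oppg g : cgamble Omega R :=
  CGamble (cg_event_neq0 g) (oppg_bounded g) (@oppg_out g).

Lemma oppgK : involutive oppg.
Proof. by move=> g; apply: cgambleP => //= w _; rewrite opprK. Qed.

(* 0|B, where B is the conditioning event of g; as a conditional event this
   is the empty event given B. *)
Definition zerog g : cgamble Omega R := cevent set0 (cg_event_neq0 g).

(* B|B, where B is the conditioning event of g *)
Definition oneg g : cgamble Omega R :=
  cevent (cg_event g) (cg_event_neq0 g).

End ConditionalGambles.

Section Consistency.
Context {Omega : Type} {R : realType}.
Implicit Types (S : set (cgamble Omega R)) (P U : cgamble Omega R -> R).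

(* A prevision on S is a total function whose values outside S are
   irrelevant. *)

Definition gain P (n : nat) (g : nat -> cgamble Omega R) (s : nat -> R)
    (w : Omega) : R :=
  \sum_(1 <= i < n.+1)
     s i * (\1_(cg_event (g i)) w * (cg_val (g i) w - P (g i)))
  - s 0%N * (\1_(cg_event (g 0%N)) w * (cg_val (g 0%N) w - P (g 0%N))).

Definition joint_event (n : nat) (g : nat -> cgamble Omega R) : set Omega :=
  \bigcup_(i in [set i | (i <= n)%N]) cg_event (g i).

Definition W_coherent S P : Prop :=
  forall (n : nat) (g : nat -> cgamble Omega R) (s : nat -> R),
    (forall i, (i <= n)%N -> S (g i)) ->
    (forall i, (i <= n)%N -> 0 <= s i) ->
    0 <= sup (gain P n g s @` joint_event n g).

Definition convex_prevision S P : Prop :=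
  forall (n : nat) (g : nat -> cgamble Omega R) (s : nat -> R),
    (forall i, (i <= n)%N -> S (g i)) ->
    (forall i, (i <= n)%N -> 0 <= s i) ->
    \sum_(1 <= i < n.+1) s i = s 0%N ->
    0 < s 0%N ->
    0 <= sup (gain P n g s @` joint_event n g).

Definition C_convex S P : Prop :=
  convex_prevision S P /\
  (forall g, S g -> S (zerog g) /\ P (zerog g) = 0).

(* The map - X|B |-> - U (X|B), using that oppg is an involution. *)
Definition conjugate U : cgamble Omega R -> R := fun g => - U (oppg g).

Definition W_coherent_upper S U : Prop := W_coherent (oppg @` S) (conjugate U).

Definition C_convex_upper S U : Prop := C_convex (oppg @` S) (conjugate U).

(* Least-committal extension from S to S' within the class coh. *)
Definition least_extension
    (coh : set (cgamble Omega R) -> (cgamble Omega R -> R) -> Prop)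
    S S' P (E : cgamble Omega R -> R) : Prop :=
  [/\ S `<=` S', coh S' E, forall g, S g -> E g = P g &
    forall Q, coh S' Q -> (forall g, S g -> Q g = P g) ->
      forall g, S' g -> E g <= Q g].

Definition greatest_extension
    (coh : set (cgamble Omega R) -> (cgamble Omega R -> R) -> Prop)
    S S' U (E : cgamble Omega R -> R) : Prop :=
  [/\ S `<=` S', coh S' E, forall g, S g -> E g = U g &
    forall Q, coh S' Q -> (forall g, S g -> Q g = U g) ->
      forall g, S' g -> Q g <= E g].

Definition natural_extension := least_extension W_coherent.
Definition convex_natural_extension := least_extension C_convex.
Definition natural_extension_upper := greatest_extension W_coherent_upper.
Definition convex_natural_extension_upper :=
  greatest_extension C_convex_upper.

Definition adjoin_zero S : set (cgamble Omega R) := S `|` zerog @` S.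

End Consistency.

Section GoodmanNguyen.
Context {Omega : Type} {R : realType}.
Variable Pt : set (set Omega).
Implicit Types (A B E : set Omega) (g : cgamble Omega R)
  (P : cgamble Omega R -> R) (Es : set (cgamble Omega R)).

Definition is_partition := partition Pt id [set: Omega].

Definition unions_of : set (set Omega) :=
  [set A | exists2 F, F `<=` Pt & A = \bigcup_(e in F) e].

Definition cevents_of : set (cgamble Omega R) :=
  [set g | exists A B (B0 : B !=set0),
     [/\ unions_of A, unions_of B & g = cevent A B0]].

Definition inner E : set Omega :=
  \bigcup_(e in [set e | Pt e /\ e `<=` E]) e.

Definition outer E : set Omega :=
  \bigcup_(e in [set e | Pt e /\ e `&` E !=set0]) e.

(* For g = C|D, the events C /\ D and ~ C /\ D (cg_true_cevent,
   cg_false_cevent), which do not depend on the choice of C. *)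
Definition cg_true g : set Omega := cg_event g `&` [set w | cg_val g w = 1].
Definition cg_false g : set Omega := cg_event g `\` cg_true g.

Lemma cg_true_cevent C D (D0 : D !=set0) : cg_true (cevent C D0) = C `&` D.
Proof.
apply/seteqP; split => w /= [].
  move=> Dw /=; rewrite patchE mem_set// indicE => Cw; split=> //.
  apply: contrapT => nCw; move: Cw; rewrite memNset//= => /esym/eqP.
  by rewrite oner_eq0.
by move=> Cw Dw; split=> //=; rewrite patchE mem_set// indicE mem_set.
Qed.

Lemma cg_false_cevent C D (D0 : D !=set0) :
  cg_false (cevent C D0) = ~` C `&` D.
Proof.
rewrite /cg_false cg_true_cevent /=.
apply/seteqP; split => w /= [H1 H2].
  by split=> // Cw; apply: H2.
by split=> // -[].
Qed.

(* A|B if B is nonempty; g is a dummy value otherwise. *)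
Definition cevent_or g A B : cgamble Omega R :=
  match pselect (B !=set0) with
  | left B0 => cevent A B0
  | right _ => g
  end.

(* For a conditional event g different from zerog g and oneg g, the
   conditioning events below are nonempty (nontrivial_true,
   nontrivial_false, outer_neq0), so that the dummy value is not used. *)

(* (C|D)_* *)
Definition lower_star g : cgamble Omega R :=
  cevent_or g (inner (cg_true g)) (inner (cg_true g) `|` outer (cg_false g)).

(* (C|D)^* *)
Definition upper_star g : cgamble Omega R :=
  cevent_or g (outer (cg_true g)) (outer (cg_true g) `|` inner (cg_false g)).

Lemma outer_neq0 E : is_partition -> E !=set0 -> outer E !=set0.
Proof.
move=> [covP _ _] [w Ew]; have : cover Pt id w by rewrite covP.
by move=> [e Pe ew]; exists w, e => //; split=> //; exists w.
Qed.

Lemma nontrivial_true g : is_cevent g -> g <> zerog g -> cg_true g !=set0.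
Proof.
move=> [C [D [D0 ->]]] nz; rewrite cg_true_cevent.
apply/set0P/eqP => CD0; apply: nz; apply: cgambleP => //= w Dw.
rewrite !patchE mem_set// !indicE in_set0 memNset// => Cw.
by have : (C `&` D) w by []; rewrite CD0.
Qed.

Lemma nontrivial_false g : is_cevent g -> g <> oneg g -> cg_false g !=set0.
Proof.
move=> [C [D [D0 ->]]] nz; rewrite cg_false_cevent.
apply/set0P/eqP => CD0; apply: nz; apply: cgambleP => //= w Dw.
rewrite !patchE mem_set// !indicE !mem_set//; apply: contrapT => nCw.
by have : (~` C `&` D) w by []; rewrite CD0.
Qed.

(* The extension takes the starred values on Es, agrees with P on the rest of
   cevents_of, and is 0 elsewhere; 0 is the value to be taken at the events
   0|D adjoined in the C-convex case. *)

Definition lower_GN Es P : cgamble Omega R -> R := fun g =>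
  if `[< Es g >] then P (lower_star g)
  else if `[< cevents_of g >] then P g else 0.

Definition upper_GN Es P : cgamble Omega R -> R := fun g =>
  if `[< Es g >] then P (upper_star g)
  else if `[< cevents_of g >] then P g else 0.

End GoodmanNguyen.

Arguments cevents_of {Omega R} Pt.

(* Main.v *)
(* Write h for the starred event of g = C|D, and p = P(h). On each atom of the
   partition, the bet on h at rate p is constant and equals the minimum of the
   bet on g at the same rate p: the infimum over the atom is attained. Hence
   replacing each g_i by its h_i lowers the terms bought in a gain (i >= 1),
   whereas the term sold (i = 0) attains the same value at some point of every
   atom. This transfers coherence from P to its extension, up to the fact that
   the point found might lie outside all the conditioning events; this is
   excluded by dropping first the bets that can only lose a negligible amount.
   That the extension is least-committal is monotonicity of a coherent lower
   prevision with respect to the Goodman-Nguyen relation between h and g. *)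

Require Import Defs.
From mathcomp Require Import all_boot all_order all_algebra.
From mathcomp Require Import all_classical all_reals all_analysis.
From mathcomp Require Import lra.

Set Implicit Arguments.
Unset Strict Implicit.
Unset Printing Implicit Defensive.

Import Order.TTheory GRing.Theory Num.Theory.

Local Open Scope classical_set_scope.
Local Open Scope ring_scope.

(** * Bets, gains and the bounds that coherence imposes *)

Section Coherence.
Context {Omega : Type} {R : realType}.
Implicit Types (S : set (cgamble Omega R)) (P Q : cgamble Omega R -> R).
Implicit Types (g h : cgamble Omega R) (K : nat -> (nat -> R) -> Prop).

Definition bet P g (w : Omega) : R :=
  \1_(cg_event g) w * (cg_val g w - P g).

Lemma bet_in P g w : cg_event g w -> bet P g w = cg_val g w - P g.
Proof. by move=> gw; rewrite /bet indicE mem_set// mul1r. Qed.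

Lemma bet_out P g w : ~ cg_event g w -> bet P g w = 0.
Proof. by move=> gw; rewrite /bet indicE memNset// mul0r. Qed.

Lemma gainE P n (g : nat -> cgamble Omega R) s w : gain P n g s w =
  \sum_(1 <= i < n.+1) s i * bet P (g i) w - s 0%N * bet P (g 0%N) w.
Proof. by []. Qed.

(* W-coherence and convexity differ only in the stakes they allow. *)
Definition coherent_for K S P : Prop :=
  forall (n : nat) (g : nat -> cgamble Omega R) (s : nat -> R),
    (forall i, (i <= n)%N -> S (g i)) ->
    (forall i, (i <= n)%N -> 0 <= s i) ->
    K n s ->
    0 <= sup (gain P n g s @` joint_event n g).

Definition any_stakes (n : nat) (s : nat -> R) := True.

Definition convex_stakes (n : nat) (s : nat -> R) :=
  \sum_(1 <= i < n.+1) s i = s 0%N /\ 0 < s 0%N.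

Lemma W_coherentE S P : W_coherent S P <-> coherent_for any_stakes S P.
Proof.
by split=> [coh n g s Sg s0 _|coh n g s Sg s0]; exact: coh.
Qed.

Lemma convex_previsionE S P :
  convex_prevision S P <-> coherent_for convex_stakes S P.
Proof.
split=> [coh n g s Sg s0 [? ?]|coh n g s Sg s0 ? ?]; first exact: coh.
by apply: coh => //; split.
Qed.

Lemma joint_event_neq0 n (g : nat -> cgamble Omega R) :
  joint_event n g !=set0.
Proof. by have [w gw] := cg_event_neq0 (g 0%N); exists w, 0%N. Qed.

Lemma bet_bounded P g : exists M, forall w, `|bet P g w| <= M.
Proof.
have [M [_ /(_ (M + 1))]] := cg_bounded g.
rewrite ltrDl ltr01 => /(_ isT) bM; exists (M + 1 + `|P g|) => w.
have M0 : `|cg_val g w| <= M + 1 by exact: bM.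
have [gw|gw] := pselect (cg_event g w).
  by rewrite bet_in// (le_trans (ler_normB _ _))// lerD2r.
by rewrite bet_out// normr0 addr_ge0// (le_trans _ M0).
Qed.

Lemma gain_has_ubound P n (g : nat -> cgamble Omega R) s (A : set Omega) :
  has_ubound (gain P n g s @` A).
Proof.
have [M bM] := choice (fun i => bet_bounded P (g i)).
exists (\sum_(1 <= i < n.+1) `|s i| * M i + `|s 0%N| * M 0%N) => _ [w _ <-].
rewrite gainE (le_trans (ler_norm _))// (le_trans (ler_normB _ _))//.
apply: lerD; last by rewrite normrM ler_wpM2l.
rewrite (le_trans (ler_norm_sum _ _ _))// ler_sum// => i _.
by rewrite normrM ler_wpM2l.
Qed.

(** The supremum need not be attained, so coherence is used through points where the gain exceeds
    [- e]. *)
Lemma gain_near_ge0 P n (g : nat -> cgamble Omega R) s e : 0 < e ->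
  0 <= sup (gain P n g s @` joint_event n g) ->
  exists2 w, joint_event n g w & - e < gain P n g s w.
Proof.
move=> e0 sup0; apply: contrapT => none.
suff : sup (gain P n g s @` joint_event n g) <= - e.
  by move=> /(le_trans sup0); rewrite oppr_ge0 leNgt e0.
apply: ge_sup; first exact/image_nonempty/joint_event_neq0.
move=> _ [w gw <-]; rewrite leNgt; apply/negP => lt.
by apply: none; exists w.
Qed.

Lemma sup_gain_ge0 P n (g : nat -> cgamble Omega R) s :
  (forall e, 0 < e ->
    exists2 w, joint_event n g w & - e <= gain P n g s w) ->
  0 <= sup (gain P n g s @` joint_event n g).
Proof.
move=> near; apply/ler_addgt0Pl => e e0.
have [w gw lew] := near e e0.
rewrite -lerBlDl sub0r (le_trans lew)//; apply: ub_le_sup.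
  exact: gain_has_ubound.
by exists w.
Qed.

Lemma coherent_near K S P n (g : nat -> cgamble Omega R) s e :
  coherent_for K S P ->
  (forall i, (i <= n)%N -> S (g i)) -> (forall i, (i <= n)%N -> 0 <= s i) ->
  K n s -> 0 < e ->
  exists2 w, joint_event n g w & - e < gain P n g s w.
Proof. by move=> coh Sg s0 Kns e0; apply: gain_near_ge0 => //; exact: coh. Qed.

(** Buy [g] and sell [h] at unit stakes, which both the W-coherent and the convex case allow. *)
Lemma coherent_pair K S P g h e : coherent_for K S P -> K 1%N (cst 1) ->
  S g -> S h -> 0 < e ->
  exists2 w, cg_event g w \/ cg_event h w & - e < bet P g w - bet P h w.
Proof.
move=> coh K1 Sg Sh e0.
have [|w [i /= i1 iw]] :=
  @coherent_near K S P 1 (fun i => if i is 0%N then h else g) (cst 1) e coh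
    _ (fun _ _ => ler01) K1 e0; first by case.
rewrite gainE big_nat1 /= !mul1r => lt; exists w => //.
by case: i i1 iw => [|i] _ iw; [right|left].
Qed.

Lemma zerog_val g w : cg_val (zerog g) w = 0.
Proof. by rewrite /= /patch; case: ifP => // _; rewrite indicE in_set0. Qed.

Lemma bet_zerog P g w : P (zerog g) = 0 -> bet P (zerog g) w = 0.
Proof. by move=> P0; rewrite /bet P0 zerog_val subrr mulr0. Qed.

(** The null gamble is bought and [g] is sold at equal stakes, so the argument also covers
    convexity. *)
Lemma coherent_lower_bound K S P g y : coherent_for K S P ->
  K 1%N (cst 1) -> S g -> S (zerog g) -> P (zerog g) = 0 ->
  (forall w, cg_event g w -> y <= cg_val g w) -> y <= P g.
Proof.
move=> coh K1 Sg Sz Pz yg; apply/ler_addgt0Pr => e e0.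
have [w gw] := coherent_pair coh K1 Sz Sg e0.
have {}gw : cg_event g w by case: gw.
rewrite bet_zerog// bet_in//; have := yg _ gw; lra.
Qed.

Lemma coherent_upper_bound K S P g x : coherent_for K S P ->
  K 1%N (cst 1) -> S g -> S (zerog g) -> P (zerog g) = 0 ->
  (forall w, cg_event g w -> cg_val g w <= x) -> P g <= x.
Proof.
move=> coh K1 Sg Sz Pz xg; apply/ler_addgt0Pr => e e0.
have [w gw] := coherent_pair coh K1 Sg Sz e0.
have {}gw : cg_event g w by case: gw.
rewrite bet_zerog// bet_in//; have := xg _ gw; lra.
Qed.

(** With arbitrary stakes [g] can be sold alone ([n = 0]). This serves domains that may lack null
    gambles. *)
Lemma W_coherent_lower_bound S P g y : W_coherent S P -> S g ->
  (forall w, cg_event g w -> y <= cg_val g w) -> y <= P g.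
Proof.
move=> /W_coherentE coh Sg yg; apply/ler_addgt0Pr => e e0.
have [w [i _ gw]] := @coherent_near _ S P 0 (cst g) (cst 1) e coh
   (fun _ _ => Sg) (fun _ _ => ler01) I e0.
rewrite gainE big_geq//= bet_in// !mul1r; have := yg _ gw; lra.
Qed.

Lemma W_coherent_zerog S P g : W_coherent S P -> S (zerog g) ->
  P (zerog g) = 0.
Proof.
move=> Wcoh Sz; apply/eqP; rewrite eq_le; apply/andP; split; last first.
  by apply: (W_coherent_lower_bound Wcoh) => // w _; rewrite zerog_val.
apply/ler_addgt0Pr => e e0; have /W_coherentE coh := Wcoh.
(* The stake on the sold bet is 0: only the bought copy of [zerog g] remains. *)
have [|w [i _ gw]] := @coherent_near _ S P 1 (cst (zerog g))
   (fun i => (i == 1%N)%:R) e coh (fun _ _ => Sz) _ I e0 => //.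
rewrite gainE big_nat1 /= bet_in// zerog_val; lra.
Qed.

End Coherence.

Section GoodmanNguyen.
Context {Omega : Type} {R : realType}.
Variable Pt : set (set Omega).
Hypothesis Pt_partition : is_partition Pt.
Implicit Types (S : set (cgamble Omega R)) (P Q E : cgamble Omega R -> R).
Implicit Types (g h : cgamble Omega R) (K : nat -> (nat -> R) -> Prop).
Implicit Types (A B F T : set Omega).

(** * Atoms, unions of atoms, inner and outer approximations *)

Lemma ex_atom (w : Omega) : exists2 e, Pt e & e w.
Proof.
have [covP _ _] := Pt_partition; have : cover Pt id w by rewrite covP.
by move=> [e Pe ew]; exists e.
Qed.

Lemma atom_eq e e' w : Pt e -> Pt e' -> e w -> e' w -> e = e'.
Proof.
move=> Pe Pe' ew ew'; have [_ /(_ e e' Pe Pe') tP _] := Pt_partition.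
by apply: tP; exists w.
Qed.

Lemma inner_atom T e w : Pt e -> e w -> inner Pt T w -> e `<=` T.
Proof.
by move=> Pe ew [e' [Pe' e'T] e'w]; rewrite (atom_eq Pe Pe' ew e'w).
Qed.

Lemma outer_atom F e w : Pt e -> e w -> outer Pt F w ->
  exists2 w', e w' & F w'.
Proof.
move=> Pe ew [e' [Pe' [w' [e'w' Fw']]] e'w]; exists w' => //.
by rewrite (atom_eq Pe Pe' ew e'w).
Qed.

Lemma inner_sub T : inner Pt T `<=` T.
Proof. by move=> w [e [_ eT] /eT]. Qed.

Lemma sub_outer F : F `<=` outer Pt F.
Proof.
move=> w Fw; have [e Pe ew] := ex_atom w.
by exists e => //; split => //; exists w.
Qed.

Lemma unions_of_inner T : unions_of Pt (inner Pt T).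
Proof. by exists [set e | Pt e /\ e `<=` T] => // e []. Qed.

Lemma unions_of_outer F : unions_of Pt (outer Pt F).
Proof. by exists [set e | Pt e /\ e `&` F !=set0] => // e []. Qed.

(** Being a union of atoms becomes a condition on single atoms, which makes closure under the
    Boolean operations immediate. *)
Lemma unions_ofP A :
  unions_of Pt A <-> forall e w, Pt e -> e w -> A w -> e `<=` A.
Proof.
split=> [[F FP ->] e w Pe ew [e' Fe' e'w]|H].
  rewrite (atom_eq Pe (FP _ Fe') ew e'w); exact: bigcup_sup.
suff -> : A = inner Pt A by exact: unions_of_inner.
apply/seteqP; split=> [w Aw|]; last exact: inner_sub.
by have [e Pe ew] := ex_atom w; exists e => //; split=> //; exact: H Aw.
Qed.

Lemma unions_of0 : unions_of Pt set0.
Proof. by apply/unions_ofP. Qed.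

Lemma unions_ofU A B : unions_of Pt A -> unions_of Pt B ->
  unions_of Pt (A `|` B).
Proof.
move=> /unions_ofP uA /unions_ofP uB; apply/unions_ofP => e w Pe ew [Aw|Bw].
  by move=> v ev; left; exact: uA Aw v ev.
by move=> v ev; right; exact: uB Bw v ev.
Qed.

Lemma unions_ofI A B : unions_of Pt A -> unions_of Pt B ->
  unions_of Pt (A `&` B).
Proof.
move=> /unions_ofP uA /unions_ofP uB; apply/unions_ofP => e w Pe ew [Aw Bw].
by move=> v ev; split; [exact: uA Aw v ev|exact: uB Bw v ev].
Qed.

Lemma unions_ofC A : unions_of Pt A -> unions_of Pt (~` A).
Proof.
move=> /unions_ofP uA; apply/unions_ofP => e w Pe ew nAw v ev Av.
by apply: nAw; apply: uA Pe ev Av w ew.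
Qed.

Lemma inner_id A : unions_of Pt A -> inner Pt A = A.
Proof.
move=> /unions_ofP uA; apply/seteqP; split=> [|w Aw]; first exact: inner_sub.
by have [e Pe ew] := ex_atom w; exists e => //; split=> //; exact: uA Aw.
Qed.

Lemma outer_id A : unions_of Pt A -> outer Pt A = A.
Proof.
move=> /unions_ofP uA; apply/seteqP; split=> [w Aw|]; last exact: sub_outer.
have [e Pe ew] := ex_atom w; have [v ev Av] := outer_atom Pe ew Aw.
exact: uA Pe ev Av _ ew.
Qed.

(* For x = 1 and y = 0, h = g_*. Taking x = 0 and y = - 1 instead, -h = (-g)^*,
   so that upper previsions are covered by conjugacy. *)
Definition GN_below (x y : R) h g : Prop :=
  exists T F,
  [/\ T `&` F = set0, cg_event g = T `|` F,
      (forall w, T w -> cg_val g w = x) /\ (forall w, F w -> cg_val g w = y),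
      cg_event h = inner Pt T `|` outer Pt F &
      (forall w, inner Pt T w -> cg_val h w = x) /\
      (forall w, outer Pt F w -> cg_val h w = y)].

(** * Comparison of the bets on [h] and [g], atom by atom *)

Section GN_below_bets.
Variables (x y : R) (h g : cgamble Omega R) (P E : cgamble Omega R -> R).
Hypotheses (hg : GN_below x y h g) (yx : y <= x).

Lemma GN_below_range w : cg_event h w -> y <= cg_val h w <= x.
Proof.
have [T [F [_ _ _ -> [hx hy]]]] := hg.
by move=> [/hx|/hy] ->; rewrite lexx ?yx.
Qed.

Lemma GN_below_rangeg w : cg_event g w -> y <= cg_val g w <= x.
Proof.
have [T [F [_ -> [gx gy] _ _]]] := hg.
by move=> [/gx|/gy] ->; rewrite lexx ?yx.
Qed.

Hypotheses (yP : y <= P h) (Px : P h <= x) (EP : E g = P h).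

Lemma GN_below_bet_ge w : y - P h <= bet E g w.
Proof.
have [gw|gw] := pselect (cg_event g w); last by rewrite bet_out// subr_le0.
by rewrite bet_in// EP lerD2r; case/andP: (GN_below_rangeg gw).
Qed.

(** If the atom lies in [T], both bets are [x - P h]. If it meets [F], the bet on [h] has the worst
    value [y - P h]. Otherwise the bet on [h] is 0, and the bet on [g] is 0 or [x - P h >= 0]. *)
Lemma GN_below_bet_le e w w' : Pt e -> e w -> e w' ->
  bet P h w <= bet E g w'.
Proof.
move=> Pe ew ew'; have [T [F [TF gTF [gx gy] hTF [hx hy]]]] := hg.
have [iT|niT] := pselect (inner Pt T w).
  have Tw' : T w' by exact: (inner_atom Pe ew iT).
  rewrite bet_in ?hTF; last by left.
  by rewrite bet_in ?gTF; [rewrite hx// gx// EP|left].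
have [oF|noF] := pselect (outer Pt F w).
  rewrite bet_in ?hTF; last by right.
  by rewrite hy// GN_below_bet_ge.
rewrite bet_out ?hTF; last by case.
have [gw|gw] := pselect (cg_event g w'); last by rewrite bet_out.
move: (gw); rewrite bet_in// gTF => -[/gx ->|Fw']; first by rewrite EP subr_ge0.
by exfalso; apply: noF; exists e => //; split=> //; exists w'.
Qed.

(** The point is taken in [F] if the atom meets [F], is [w] itself if the atom lies in [T], and
    otherwise lies outside both, where the bet on [g] is 0. *)
Lemma GN_below_bet_attained e w : Pt e -> e w ->
  exists2 w', e w' &
    bet E g w' <= bet P h w /\ (cg_event h w -> cg_event g w').
Proof.
move=> Pe ew; have [T [F [TF gTF [gx gy] hTF [hx hy]]]] := hg.
have [oF|noF] := pselect (outer Pt F w).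
  have [w' ew' Fw'] := outer_atom Pe ew oF; exists w' => //; split; last first.
    by rewrite gTF; right.
  rewrite bet_in ?gTF; last by right.
  rewrite bet_in ?hTF; last by right.
  by rewrite hy// gy// EP.
have [iT|niT] := pselect (inner Pt T w).
  have Tw : T w by exact: inner_sub.
  exists w => //; split; last by rewrite gTF; left.
  rewrite bet_in ?gTF; last by left.
  rewrite bet_in ?hTF; last by left.
  by rewrite hx// gx// EP.
have nh : ~ cg_event h w by rewrite hTF => -[].
have [w' ew' nTw'] : exists2 w', e w' & ~ T w'.
  apply: contrapT => none; apply: niT; exists e => //; split=> // v ev.
  by apply: contrapT => nTv; apply: none; exists v.
exists w' => //; split=> //; rewrite !bet_out// gTF => -[//|Fw'].
by apply: noF; exists e => //; split=> //; exists w'.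
Qed.

(** An atom inside the event of [h] but not inside that of [g] is not contained in [T], so it meets
    [F]. *)
Lemma GN_below_bet_missed e w w' : Pt e -> e w -> e w' ->
  cg_event h w -> ~ cg_event g w' -> bet P h w = y - P h.
Proof.
move=> Pe ew ew'; have [T [F [TF gTF [gx gy] hTF [hx hy]]]] := hg.
move=> hw; rewrite bet_in//; move: hw; rewrite hTF => -[iT|oF].
  by rewrite gTF => -[]; left; apply: (inner_atom Pe ew iT).
by rewrite hy.
Qed.

End GN_below_bets.

(** * Transfer of coherence and minimality of the extension *)

Definition GN_covered S P E g : Prop :=
  exists h x y, [/\ S h, y <= x, GN_below x y h g & E g = P h].

(** A gain on the [g i] is compared with a gain on the [h i] at the same stakes. A point [w] where
    the latter is nearly nonnegative is moved within its atom to a point [w'] where the sold bet is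
    no larger; the bought bets are no smaller at any point of the atom. *)
Lemma GN_coherent K S S' P E :
  K 1%N (cst 1) -> coherent_for K S P ->
  (forall g, S g -> S (zerog g) /\ P (zerog g) = 0) ->
  (forall g, S' g -> GN_covered S P E g) ->
  coherent_for K S' E.
Proof.
move=> K1 coh Sz cov n g s S'g s0 Kns; apply: sup_gain_ge0 => d d0.
(* The slack [d] is split into [n.+1] equal parts: one for each bought bet and one for the
   approximate supremum. *)
pose N := n.+1%:R : R; pose e := d / N.
have N0 : 0 < N by rewrite ltr0n.
have e0 : 0 < e by rewrite divr_gt0.
have [f Hf] : {f : nat -> cgamble Omega R * (R * R) | forall i, (i <= n)%N ->
    [/\ S (f i).1, (f i).2.2 <= (f i).2.1,
        GN_below (f i).2.1 (f i).2.2 (f i).1 (g i) & E (g i) = P (f i).1]}.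
  apply: cid; have [|f Hf] := @choice nat _ (fun i f => (i <= n)%N ->
    [/\ S f.1, f.2.2 <= f.2.1, GN_below f.2.1 f.2.2 f.1 (g i) &
        E (g i) = P f.1]) _; last by exists f.
  (* Beyond [n] nothing is known about [g i], and a dummy value is chosen. *)
  move=> i; have [i_n|_] := leqP i n; last by exists (g i, (0, 0)).
  by have [h [x [y H]]] := cov _ (S'g i i_n); exists (h, (x, y)).
pose h i := (f i).1; pose x i := (f i).2.1; pose y i := (f i).2.2.
have Sh i : (i <= n)%N -> S (h i) by case/Hf.
have yx i : (i <= n)%N -> y i <= x i by case/Hf.
have GN i : (i <= n)%N -> GN_below (x i) (y i) (h i) (g i) by case/Hf.
have EP i : (i <= n)%N -> E (g i) = P (h i) by case/Hf.
have yP i : (i <= n)%N -> y i <= P (h i).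
  move=> i_n; have [S0 P0] := Sz _ (Sh i i_n).
  apply: (coherent_lower_bound coh) => // [|w hw]; first exact: Sh.
  by case/andP: (GN_below_range (GN i i_n) (yx i i_n) hw).
have Px i : (i <= n)%N -> P (h i) <= x i.
  move=> i_n; have [S0 P0] := Sz _ (Sh i i_n).
  apply: (coherent_upper_bound coh) => // [|w hw]; first exact: Sh.
  by case/andP: (GN_below_range (GN i i_n) (yx i i_n) hw).
have [Sz0 Pz0] := Sz _ (Sh 0%N isT).
(* A bet that can lose at most e is replaced by the null bet with the same
   conditioning event as h 0: otherwise the supremum of the gain could be
   reached only on an atom that is not contained in any event of the g i. *)
pose small i := (0 < i)%N && (s i * (P (h i) - y i) <= e).
pose k i := if small i then zerog (h 0%N) else h i.
have k0 : k 0%N = h 0%N by [].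
have Sk i : (i <= n)%N -> S (k i).
  by move=> i_n; rewrite /k; case: ifP => // _; exact: Sh.
have [w kw gt] := coherent_near coh Sk s0 Kns e0.
have [a Pa aw] := ex_atom w.
have [w' aw' [le0 gw0]] :=
  GN_below_bet_attained (GN 0%N isT) (EP 0%N isT) Pa aw.
have ge_i i : (i <= n)%N -> bet P (h i) w <= bet E (g i) w'.
  by move=> i_n; apply: (GN_below_bet_le (GN i i_n) _ _ _ _ Pa aw aw');
    rewrite ?yx ?yP ?Px ?EP.
exists w'.
  (* If all events of the [g i] missed [w'], no bought bet would gain at [w]. Some [k i] has an
     event containing [w]; it is neither [k 0] nor a replaced bet, since these have the event of
     [h 0]. So it loses more than [e], and the gain would be at most [- e]. *)
  apply: contrapT => ng.
  have {}ng i : (i <= n)%N -> ~ cg_event (g i) w'.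
    by move=> i_n gw; apply: ng; exists i.
  have nh0 : ~ cg_event (h 0%N) w by move/gw0; exact: ng.
  have sk_le0 i : (i <= n)%N -> s i * bet P (k i) w <= 0.
    move=> i_n; rewrite /k; case: ifP => _; first by rewrite bet_zerog ?mulr0.
    rewrite mulr_ge0_le0 ?s0// (le_trans (ge_i i i_n))// bet_out//; exact: ng.
  case: kw => i /= i_n; rewrite /k; case: ifP => [//|nsm kiw].
  have i0 : (0 < i)%N by case: i nsm kiw {i_n} => // _ /nh0.
  move: nsm; rewrite /small i0 /= => /negbT; rewrite -ltNge => big.
  have := gt; rewrite gainE k0 (bet_out _ nh0) mulr0 subr0.
  apply/negP; rewrite -leNgt.
  rewrite (bigD1_seq i) ?iota_uniq ?mem_index_iota ?i0 ?ltnS//=.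
  rewrite -[- e]addr0 lerD//.
    have -> : k i = h i by rewrite /k /small i0 /= leNgt big.
    rewrite (GN_below_bet_missed P (GN i i_n) Pa aw aw' kiw (ng i i_n)).
    by rewrite -opprB mulrN lerN2 ltW.
  rewrite big_seq_cond sumr_le0// => j /andP[].
  by rewrite mem_index_iota ltnS => /andP[_ j_n] _; exact: sk_le0.
(* For a replaced bet the left side is [- e], and the bet on [g i] loses at most [e] by
   smallness. *)
have step i : (0 < i <= n)%N -> s i * bet P (k i) w - e <= s i * bet E (g i) w'.
  move=> /andP[i0 i_n]; rewrite /k /small i0 /=; case: ifPn => [sm|_].
    rewrite bet_zerog// mulr0 sub0r.
    have := GN_below_bet_ge (GN i i_n) (yx i i_n) (yP i i_n) (EP i i_n) w'.
    move=> /(ler_wpM2l (s0 i i_n)); apply: le_trans.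
    by rewrite -opprB mulrN lerN2.
  have := ler_wpM2l (s0 i i_n) (ge_i i i_n); lra.
have : \sum_(1 <= i < n.+1) (s i * bet P (k i) w - e) <=
    \sum_(1 <= i < n.+1) s i * bet E (g i) w'.
  rewrite !big_seq; apply: ler_sum => i.
  rewrite mem_index_iota ltnS; exact: step.
rewrite sumrB sumr_const_nat subn1 /= => sum_le.
have := ler_wpM2l (s0 0%N isT) le0.
move: gt; rewrite !gainE k0 => gt le0'.
have -> : d = e *+ n + e.
  by rewrite -mulrSr -mulr_natr /e mulfVK// lt0r_neq0.
by lra.
Qed.

(** Otherwise buying [h] and selling [g] loses at least [Q h - Q g] on the whole joint event:
    [Q h <= x] gives this where only the event of [g] occurs, and [y <= Q g] where only that of [h]
    does. *)
Lemma GN_below_dominated K S Q x y h g : coherent_for K S Q ->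
  K 1%N (cst 1) -> S h -> S g -> GN_below x y h g -> y <= x ->
  Q h <= x -> y <= Q g -> Q h <= Q g.
Proof.
move=> coh K1 Sh Sg hg yx qx yq; rewrite leNgt; apply/negP => lt.
have e0 : 0 < Q h - Q g by lra.
have [w hgw] := coherent_pair coh K1 Sh Sg e0.
apply/negP; rewrite -leNgt opprB.
have [e Pe ew] := ex_atom w.
have [T [F [TF gTF [gx gy] hTF [hx hy]]]] := hg.
have [gw|gw] := pselect (cg_event g w); have [hw|hw] := pselect (cg_event h w).
- rewrite !bet_in//; move: gw hw; rewrite gTF hTF => -[Tw|Fw] [iT|oF].
  + by rewrite gx// hx//; lra.
  + by rewrite gx// hy//; lra.
  + have /(_ w ew) Tw := inner_atom Pe ew iT.
    by have : (T `&` F) w by []; rewrite TF.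
  + by rewrite gy// hy//; lra.
- rewrite (bet_in _ gw) (bet_out _ hw); move: gw; rewrite gTF => -[Tw|Fw].
    by rewrite gx//; lra.
  by exfalso; apply: hw; rewrite hTF; right; apply: sub_outer.
- rewrite (bet_out _ gw) (bet_in _ hw); move: hw; rewrite hTF => -[iT|oF].
    by exfalso; apply: gw; rewrite gTF; left; apply: inner_sub.
  by rewrite hy//; lra.
- by case: hgw.
Qed.

(** Every [g] in [S'] lies above some [h] in [S], where [Q] and [P] agree. The bound [y <= Q g]
    comes from selling [g] alone, since [S'] may lack [zerog g]. *)
Lemma GN_natural_extension S S' P E : S `<=` S' -> W_coherent S P ->
  (forall g, S g -> S (zerog g)) ->
  (forall g, S' g -> GN_covered S P E g) ->
  (forall g, S g -> E g = P g) ->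
  natural_extension S S' P E.
Proof.
move=> SS' Wcoh Sz cov EP; have /W_coherentE coh := Wcoh.
have Pz g : S g -> S (zerog g) /\ P (zerog g) = 0.
  by move=> Sg; split; [exact: Sz|apply: (W_coherent_zerog Wcoh); exact: Sz].
split=> //; first by apply/W_coherentE; apply: (GN_coherent _ coh Pz cov).
move=> Q WQ QP g S'g; have [h [x [y [Sh yx hg ->]]]] := cov g S'g.
rewrite -QP//; have /W_coherentE cohQ := WQ.
apply: (GN_below_dominated cohQ _ _ _ hg) => //; first exact: SS'.
  rewrite QP//; have [S0 P0] := Pz _ Sh.
  apply: (coherent_upper_bound coh) => // w hw.
  by case/andP: (GN_below_range hg yx hw).
apply: (W_coherent_lower_bound WQ) => // w gw.
by case/andP: (GN_below_rangeg hg yx gw).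
Qed.

(** Convexity balances the stakes, so [g] cannot be sold alone; centering supplies [zerog g] for the
    bound [y <= Q g]. *)
Lemma GN_convex_natural_extension S S' P E : S `<=` S' -> C_convex S P ->
  (forall g, S' g -> S' (zerog g) /\ E (zerog g) = 0) ->
  (forall g, S' g -> GN_covered S P E g) ->
  (forall g, S g -> E g = P g) ->
  convex_natural_extension S S' P E.
Proof.
have K1 : convex_stakes 1%N (cst 1 : nat -> R).
  by rewrite /convex_stakes big_nat1.
move=> SS' [/convex_previsionE coh Pz] Ez cov EP.
split=> //; first split=> //.
  by apply/convex_previsionE; apply: (GN_coherent K1 coh Pz cov).
move=> Q [/convex_previsionE cohQ Qz] QP g S'g.
have [h [x [y [Sh yx hg ->]]]] := cov g S'g.
rewrite -QP//; apply: (GN_below_dominated cohQ K1 _ _ hg) => //.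
- exact: SS'.
- rewrite QP//; have [S0 P0] := Pz _ Sh.
  apply: (coherent_upper_bound coh) => // w hw.
  by case/andP: (GN_below_range hg yx hw).
- have [S0 Q0] := Qz _ S'g.
  apply: (coherent_lower_bound cohQ) => // w gw.
  by case/andP: (GN_below_rangeg hg yx gw).
Qed.

(** * Conditional events and their starred events *)

Lemma cevent_val A B (B0 : B !=set0) w :
  B w -> cg_val (cevent A B0 : cgamble Omega R) w = \1_A w.
Proof. by move=> Bw; rewrite /= /patch mem_set. Qed.

Lemma oppg_val g w : cg_val (oppg g) w = - cg_val g w.
Proof. by []. Qed.

Lemma cevents_of_cevent g : cevents_of Pt g -> is_cevent g.
Proof. by move=> [A [B [B0 [_ _ ->]]]]; exists A, B, B0. Qed.

Lemma cg_trueUfalse g : cg_true g `|` cg_false g = cg_event g.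
Proof.
apply/seteqP; split=> w; first by move=> [[]|[]].
by move=> gw; have [tw|tw] := pselect (cg_true g w); [left|right].
Qed.

Lemma cg_trueIfalse g : cg_true g `&` cg_false g = set0.
Proof. by rewrite -subset0 => w [tw [_ /(_ tw)]]. Qed.

Lemma cg_false_val g w : is_cevent g -> cg_false g w -> cg_val g w = 0.
Proof.
move=> [A [B [B0 ->]]]; rewrite cg_false_cevent => -[nAw Bw].
by rewrite cevent_val// indicE memNset.
Qed.

Lemma inner_disj_outer T F : T `&` F = set0 ->
  inner Pt T `&` outer Pt F = set0.
Proof.
move=> TF; rewrite -subset0 => w [iT oF].
have [e Pe ew] := ex_atom w; have [v ev Fv] := outer_atom Pe ew oF.
have : (T `&` F) v by split=> //; exact: (inner_atom Pe ew iT).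
by rewrite TF.
Qed.

Lemma cevent_orE g A B (B0 : B !=set0) : cevent_or g A B = cevent A B0.
Proof.
rewrite /cevent_or; case: pselect => // B0'.
exact: cgambleP.
Qed.

Lemma lower_starE g
  (B0 : inner Pt (cg_true g) `|` outer Pt (cg_false g) !=set0) :
  lower_star Pt g = cevent (inner Pt (cg_true g)) B0.
Proof. exact: cevent_orE. Qed.

Lemma upper_starE g
  (B0 : outer Pt (cg_true g) `|` inner Pt (cg_false g) !=set0) :
  upper_star Pt g = cevent (outer Pt (cg_true g)) B0.
Proof. exact: cevent_orE. Qed.

Lemma lower_star_neq0 g : cg_false g !=set0 ->
  inner Pt (cg_true g) `|` outer Pt (cg_false g) !=set0.
Proof. by move=> [w fw]; exists w; right; exact: sub_outer. Qed.

Lemma upper_star_neq0 g : cg_true g !=set0 ->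
  outer Pt (cg_true g) `|` inner Pt (cg_false g) !=set0.
Proof. by move=> [w tw]; exists w; left; exact: sub_outer. Qed.

Lemma lower_star_cevents_of g : cg_false g !=set0 ->
  cevents_of Pt (lower_star Pt g).
Proof.
move=> /lower_star_neq0 B0; rewrite (lower_starE B0); do 3 eexists.
split; last reflexivity; first exact: unions_of_inner.
by apply: unions_ofU; [exact: unions_of_inner|exact: unions_of_outer].
Qed.

Lemma upper_star_cevents_of g : cg_true g !=set0 ->
  cevents_of Pt (upper_star Pt g).
Proof.
move=> /upper_star_neq0 B0; rewrite (upper_starE B0); do 3 eexists.
split; last reflexivity; first exact: unions_of_outer.
by apply: unions_ofU; [exact: unions_of_outer|exact: unions_of_inner].
Qed.

Lemma GN_below_lower_star g : is_cevent g ->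
  inner Pt (cg_true g) `|` outer Pt (cg_false g) !=set0 ->
  GN_below 1 0 (lower_star Pt g) g.
Proof.
move=> cg B0; exists (cg_true g), (cg_false g); rewrite (lower_starE B0).
split=> //; first exact: cg_trueIfalse.
- by rewrite cg_trueUfalse.
- by split=> [w []//|w]; exact: cg_false_val.
- split=> w ?; first by rewrite cevent_val ?indicE ?mem_set//; left.
  rewrite cevent_val ?indicE ?memNset//; last by right.
  move=> iw; have := inner_disj_outer (cg_trueIfalse g).
  by apply/eqP/set0P; exists w.
Qed.

(** Negation exchanges the roles: [oppg g] has its larger value 0 on [cg_false g] and its smaller
    value [- 1] on [cg_true g]. *)
Lemma GN_below_upper_star g : is_cevent g ->
  outer Pt (cg_true g) `|` inner Pt (cg_false g) !=set0 ->
  GN_below 0 (- 1) (oppg (upper_star Pt g)) (oppg g).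
Proof.
move=> cg B0; exists (cg_false g), (cg_true g); rewrite (upper_starE B0).
split; first by rewrite setIC cg_trueIfalse.
- by rewrite /= setUC cg_trueUfalse.
- split=> w; first by move=> /(cg_false_val cg) /= ->; rewrite oppr0.
  by move=> [_ /= ->].
- by rewrite /= setUC.
- have disj : inner Pt (cg_false g) `&` outer Pt (cg_true g) = set0.
    by apply: inner_disj_outer; rewrite setIC cg_trueIfalse.
  split=> w ?; rewrite oppg_val cevent_val ?indicE.
  + rewrite memNset /= ?oppr0// => ow.
    by move: disj; apply/eqP/set0P; exists w.
  + by right.
  + by rewrite mem_set.
  + by left.
Qed.

Lemma unions_of_true_false g : cevents_of Pt g ->
  unions_of Pt (cg_true g) /\ unions_of Pt (cg_false g).
Proof.
move=> [A [B [B0 [uA uB ->]]]]; rewrite cg_true_cevent cg_false_cevent.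
by split; apply: unions_ofI => //; exact: unions_ofC.
Qed.

Lemma cevent_true g (B0 : cg_event g !=set0) : is_cevent g ->
  cevent (cg_true g) B0 = g.
Proof.
move=> cg; apply: cgambleP => // w gw; rewrite cevent_val// indicE.
have [tw|tw] := pselect (cg_true g w).
  by rewrite mem_set//; case: tw => _ ->.
by rewrite memNset// cg_false_val.
Qed.

(** Inner and outer approximations fix unions of atoms. Hence the extension agrees with [P] even on
    events shared by [Es] and [cevents_of Pt]. *)
Lemma lower_star_id g : cevents_of Pt g -> lower_star Pt g = g.
Proof.
move=> cg; have [uT uF] := unions_of_true_false cg.
rewrite /lower_star !inner_id// outer_id// cg_trueUfalse.
rewrite (cevent_orE _ _ (cg_event_neq0 g)) cevent_true//.
exact: cevents_of_cevent.
Qed.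

Lemma upper_star_id g : cevents_of Pt g -> upper_star Pt g = g.
Proof.
move=> cg; have [uT uF] := unions_of_true_false cg.
rewrite /upper_star !inner_id// outer_id// cg_trueUfalse.
rewrite (cevent_orE _ _ (cg_event_neq0 g)) cevent_true//.
exact: cevents_of_cevent.
Qed.

(** As [g] is its own starred event, events already assessed fit the same scheme as new ones. *)
Lemma cevents_of_below g : cevents_of Pt g -> GN_below 1 0 g g.
Proof.
move=> cg; rewrite -{1}(lower_star_id cg).
have [uT uF] := unions_of_true_false cg.
apply: GN_below_lower_star; first exact: cevents_of_cevent.
by rewrite inner_id// outer_id// cg_trueUfalse; exact: cg_event_neq0.
Qed.

Lemma cevents_of_below_opp g : cevents_of Pt g ->
  GN_below 0 (- 1) (oppg g) (oppg g).
Proof.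
move=> cg; rewrite -{1}(upper_star_id cg).
have [uT uF] := unions_of_true_false cg.
apply: GN_below_upper_star; first exact: cevents_of_cevent.
by rewrite inner_id// outer_id// cg_trueUfalse; exact: cg_event_neq0.
Qed.

(** * Null gambles and conjugacy *)

Lemma zerog_cevents_of g : cevents_of Pt g -> cevents_of Pt (zerog g).
Proof.
move=> [A [B [B0 [_ uB ->]]]]; exists set0, B, B0; split=> //.
exact: unions_of0.
Qed.

Lemma zerog_oppg g : zerog (oppg g) = zerog g :> cgamble Omega R.
Proof. exact: cgambleP. Qed.

Lemma oppg_zerog g : oppg (zerog g) = zerog g :> cgamble Omega R.
Proof.
apply: cgambleP => // w _.
by rewrite oppg_val !zerog_val oppr0.
Qed.

Lemma zerog_zerog g : zerog (zerog g) = zerog g :> cgamble Omega R.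
Proof. exact: cgambleP. Qed.

(** With [D] the event of [g], the gamble [0|D] is covered by the null event given [outer Pt D]: [T]
    is empty, [F] is [D] and [x = y = 0]. Null gambles being fixed by [oppg], this serves lower and
    upper previsions alike. *)
Lemma GN_below_zerog g : exists2 h, cevents_of Pt (zerog h) &
  GN_below 0 0 (zerog h) (zerog g).
Proof.
have D0 : outer Pt (cg_event g) !=set0.
  by have [w gw] := cg_event_neq0 g; exists w; exact: sub_outer.
pose h : cgamble Omega R := cevent set0 D0; exists h.
  apply: zerog_cevents_of; exists set0, _, D0; split=> //.
    exact: unions_of0.
  exact: unions_of_outer.
have i0 : inner Pt (set0 : set Omega) = set0.
  by rewrite -subset0; exact: inner_sub.
exists set0, (cg_event g); split=> //; rewrite ?set0I ?i0 ?set0U//.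
- by split=> // w _; exact: zerog_val.
- by split=> // w _; exact: zerog_val.
Qed.

(** Negating gambles and values reverses inequalities, and the involution [oppg] carries domains
    back and forth. *)
Lemma greatest_extension_conjugate
    (coh : set (cgamble Omega R) -> (cgamble Omega R -> R) -> Prop)
    S S' (U E : cgamble Omega R -> R) :
  least_extension coh (oppg @` S) (oppg @` S') (conjugate U) (conjugate E) ->
  greatest_extension (fun S U => coh (oppg @` S) (conjugate U)) S S' U E.
Proof.
move=> [SS' cohE EU least]; split=> //.
- move=> g Sg; have [|g' S'g' eq_g] := SS' (oppg g); first by exists g.
  by rewrite -(oppgK g) -eq_g oppgK.
- move=> g Sg; have := EU (oppg g) (ex_intro2 _ _ g Sg erefl).
  by rewrite /conjugate oppgK => /oppr_inj.
- move=> Q cohQ QU g S'g.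
  have := least (conjugate Q) cohQ _ (oppg g) (ex_intro2 _ _ g S'g erefl).
  rewrite /conjugate oppgK lerN2; apply=> _ [g' Sg' <-].
  by rewrite oppgK QU.
Qed.

End GoodmanNguyen.

Theorem proposition6 (Omega : Type) (R : realType)
  (Omega_neq0 : [set: Omega] !=set0)
  (Pt : set (set Omega)) (Pt_partition : is_partition Pt)
  (Es : set (cgamble Omega R))
  (Es_cevent : forall g, Es g -> is_cevent g)
  (Es_nontrivial : forall g, Es g -> g <> zerog g /\ g <> oneg g) :
  (forall P : cgamble Omega R -> R,
     (W_coherent (cevents_of Pt) P ->
      natural_extension (cevents_of Pt) (cevents_of Pt `|` Es)
        P (lower_GN Pt Es P)) /\
     (C_convex (cevents_of Pt) P ->
      convex_natural_extension (cevents_of Pt)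
        (adjoin_zero (cevents_of Pt `|` Es)) P (lower_GN Pt Es P))) /\
  (forall U : cgamble Omega R -> R,
     (W_coherent_upper (cevents_of Pt) U ->
      natural_extension_upper (cevents_of Pt) (cevents_of Pt `|` Es)
        U (upper_GN Pt Es U)) /\
     (C_convex_upper (cevents_of Pt) U ->
      convex_natural_extension_upper (cevents_of Pt)
        (adjoin_zero (cevents_of Pt `|` Es)) U (upper_GN Pt Es U))).
Proof.
have Es_true g : Es g -> cg_true g !=set0.
  by move=> Eg; have [? _] := Es_nontrivial g Eg;
    apply: nontrivial_true => //; exact: Es_cevent.
have Es_false g : Es g -> cg_false g !=set0.
  by move=> Eg; have [_ ?] := Es_nontrivial g Eg;
    apply: nontrivial_false => //; exact: Es_cevent.
(* [zerog] is idempotent, so a null event equals its own [zerog], which nontriviality forbids. *)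
have Es_zerog g : ~ Es (zerog g).
  by move=> /Es_nontrivial[+ _]; rewrite zerog_zerog.
have adjoin_zerog (S : set (cgamble Omega R)) g :
    adjoin_zero S g -> adjoin_zero S (zerog g).
  by move=> [Sg|[g' Sg' <-]]; right; [exists g|exists g'; rewrite ?zerog_zerog].
split=> [P|U].
- pose E := lower_GN Pt Es P.
  have Ecev g : cevents_of Pt g -> E g = P g.
    rewrite /E /lower_GN => cg; case: asboolP => _.
      by rewrite lower_star_id.
    by case: asboolP.
  have cov g : (cevents_of Pt `|` Es) g -> GN_covered Pt (cevents_of Pt) P E g.
    move=> [cg|Eg].
      by exists g, 1, 0; split=> //; [exact: cevents_of_below|exact: Ecev].
    exists (lower_star Pt g), 1, 0; split=> //.
    + by apply: lower_star_cevents_of => //; exact: Es_false.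
    + apply: GN_below_lower_star; [by []|exact: Es_cevent|].
      by apply: lower_star_neq0 => //; exact: Es_false.
    + by rewrite /E /lower_GN; case: asboolP.
  split=> [WP|CP].
    apply: (GN_natural_extension Pt_partition) => // g.
    exact: zerog_cevents_of.
  have [_ Pz] := CP.
  (* A null event either lies in [cevents_of Pt], where centering gives 0, or takes the default
     value 0 of [lower_GN]. *)
  have Ez g : E (zerog g) = 0.
    rewrite /E /lower_GN; case: asboolP => [/Es_zerog//|_].
    by case: asboolP => // /Pz[_]; rewrite zerog_zerog.
  apply: (GN_convex_natural_extension Pt_partition) => //.
  + by move=> g cg; left; left.
  + by move=> g S'g; split=> //; exact: adjoin_zerog.
  + move=> g [|[g' _ <-]]; first exact: cov.
    have [h ch hg] := GN_below_zerog Pt_partition g'.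
    exists (zerog h), 0, 0; split=> //; rewrite -/E Ez.
    by have [_] := Pz _ ch; rewrite zerog_zerog.
- pose E := upper_GN Pt Es U.
  have Ecev g : cevents_of Pt g -> E g = U g.
    rewrite /E /upper_GN => cg; case: asboolP => _.
      by rewrite upper_star_id.
    by case: asboolP.
  have cov g : (cevents_of Pt `|` Es) g ->
      GN_covered Pt (oppg @` cevents_of Pt) (conjugate U) (conjugate E)
        (oppg g).
    move=> [cg|Eg].
      exists (oppg g), 0, (- 1); split.
      + by exists g.
      + by rewrite lerN10.
      + exact: cevents_of_below_opp.
      + by rewrite /conjugate oppgK Ecev.
    exists (oppg (upper_star Pt g)), 0, (- 1); split.
    + exists (upper_star Pt g) => //.
      by apply: upper_star_cevents_of => //; exact: Es_true.
    + by rewrite lerN10.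
    + apply: GN_below_upper_star; [by []|exact: Es_cevent|].
      by apply: upper_star_neq0 => //; exact: Es_true.
    + by rewrite /conjugate !oppgK /E /upper_GN; case: asboolP.
  have Eop g : (oppg @` cevents_of Pt) g -> conjugate E g = conjugate U g.
    by move=> [g' cg' <-]; rewrite /conjugate oppgK Ecev.
  split=> [WU|CU]; apply: greatest_extension_conjugate.
    apply: (GN_natural_extension Pt_partition) => //.
    + by move=> _ [g cg <-]; exists g => //; left.
    + move=> _ [g cg <-]; exists (zerog g); first exact: zerog_cevents_of.
      by rewrite oppg_zerog zerog_oppg.
    + by move=> _ [g S'g <-]; exact: cov.
  have [_ Uz] := CU.
  (* Centering is assumed of the conjugate; since [oppg] fixes null gambles, it passes to [U]. *)
  have {}Uz g : cevents_of Pt (zerog g) -> U (zerog g) = 0.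
    move=> cz; have [|_] := Uz (zerog g).
      by exists (zerog g); rewrite ?oppg_zerog.
    by rewrite zerog_zerog /conjugate oppg_zerog => /eqP; rewrite oppr_eq0 => /eqP.
  have Ez g : conjugate E (zerog g) = 0.
    rewrite /conjugate oppg_zerog /E /upper_GN; case: asboolP => [/Es_zerog//|_].
    by case: asboolP => [/Uz ->|_]; rewrite oppr0.
  apply: (GN_convex_natural_extension Pt_partition) => //.
  + by move=> _ [g cg <-]; exists g => //; left; left.
  + move=> _ [g S'g <-]; rewrite zerog_oppg; split=> //.
    by exists (zerog g); [exact: adjoin_zerog|exact: oppg_zerog].
  + move=> _ [g + <-] => -[|[g' _ <-]]; first exact: cov.
    have [h ch hg] := GN_below_zerog Pt_partition g'.
    rewrite oppg_zerog; exists (zerog h), 0, 0; split=> //.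
      by exists (zerog h) => //; exact: oppg_zerog.
    by rewrite -/E Ez /conjugate oppg_zerog Uz ?oppr0.
Qed.
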